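(* Let $d>2$ be an integer, let $\mathbb{k}$ be a field of characteristic $0$ or of characteristic greater than $d$, and let $r,n\ge 1$ be integers. Let $x=(x_1,\dots,x_r)$ and $y=(y_1,\dots,y_n)$ be two systems of independent indeterminates over $\mathbb{k}$. Then there exist $z_1,\dots,z_n\in \mathbb{k}(x)[y]$, each of which is a linear form in $y_1,\dots,y_n$ with coefficients in the rational function field $\mathbb{k}(x)=\mathbb{k}(x_1,\dots,x_r)$, such that \[ (x_1^d + x_2^d + \cdots + x_r^d)\,(y_1^d + y_2^d + \cdots + y_n^d) = z_1^d + z_2^d + \cdots + z_n^d \] holds in $\mathbb{k}(x)[y]$ if and only if $r=1$.
   Context: A linear form in $y$ with coefficients in $\mathbb{k}(x)$ is an expression $\sum_{j=1}^n c_j y_j$ with all $c_j\in\mathbb{k}(x)$ (the zero form is allowed). *)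

(* Defs.v *)
From HB Require Import structures.
From mathcomp Require Import all_boot all_order all_algebra.
From mathcomp Require Import mpoly.

Set Implicit Arguments.
Unset Strict Implicit.
Unset Printing Implicit Defensive.

Import GRing.Theory.

Local Open Scope ring_scope.

Definition ratvar (k : fieldType) (r : nat) (i : 'I_r) :
    {fraction {mpoly k[r]}} :=
  tofrac ('X_i : {mpoly k[r]}).

(* In particular a linear form has no constant term. *)
Definition linear_form (K : fieldType) (n : nat) (z : {mpoly K[n]}) : Prop :=
  exists c : 'I_n -> K, z = \sum_(j < n) c j *: 'X_j.

(* Main.v *)
(* A linear substitution [A] multiplying the Fermat form [sum y_j^d] by [c <> 0]
   satisfies, by comparing Hessians, [A^T diag(z_i^(d-2)) A = c diag(y_j^(d-2))].
   At a basis vector the right-hand side has rank one, which forces [A] to be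
   monomial, so [c] is a [d]th power. For [r >= 2] the sum [x_1^d + ... + x_r^d]
   is not a [d]th power in [k(x)]: as a polynomial in [x_1] it is separable. *)
Require Import Defs.
From mathcomp Require Import all_boot all_order all_algebra.
From mathcomp Require Import mpoly.
From mathcomp Require Import ring.

Import GRing.Theory.
Local Open Scope ring_scope.

Lemma mderiv_exp (n : nat) (R : comNzRingType) (i : 'I_n) (p : {mpoly R[n]})
  (m : nat) : (p ^+ m)^`M(i) = (m%:R)%:MP * (p ^+ m.-1 * p^`M(i)).
Proof.
elim: m => [|m IHm]; first by rewrite expr0 -mpolyC1 mderivC mpolyC0 mul0r.
rewrite exprS mderivM IHm /= -[m.+1]addn1 natrD mpolyCD mpolyC1.
(* The truncated [m.-1] breaks [p * p ^+ m.-1 = p ^+ m] at [m = 0], where the coefficient is zero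
   anyway. *)
case: m {IHm} => [|m] /=; first by rewrite mpolyC0; ring.
by rewrite exprS; ring.
Qed.

Lemma mderivXU (n : nat) (R : comNzRingType) (i j : 'I_n) :
  ('X_j : {mpoly R[n]})^`M(i) = (j == i)%:R%:MP.
Proof.
rewrite mderivX mnm1E; case: eqVneq => [->|_]; last by rewrite scale0r mpolyC0.
by rewrite -{1}[U_(i)%MM]add0m addmK mpolyX0 scale1r mpolyC1.
Qed.

Lemma mderiv_linear_form (n : nat) (R : comNzRingType) (c : 'I_n -> R)
  (i : 'I_n) : (\sum_(j < n) c j *: 'X_j : {mpoly R[n]})^`M(i) = (c i)%:MP.
Proof.
rewrite raddf_sum (bigD1 i) //= big1 => [|j ne_ji].
  by rewrite mderivZ mderivXU eqxx mpolyC1 alg_mpolyC addr0.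
by rewrite mderivZ mderivXU (negbTE ne_ji) mpolyC0 scaler0.
Qed.

(** The derivatives of [p i] involved are constants, so differentiating each power twice leaves a
    single term. Variables and linear forms both qualify, hence one computation serves both sides of
    the identity. *)
Lemma meval_hessian_sum_exp (I : finType) (n : nat) (R : comNzRingType)
  (m : nat) (p : I -> {mpoly R[n]}) (a b : I -> R) (k l : 'I_n)
  (v : 'I_n -> R) :
  (forall i, (p i)^`M(k) = (a i)%:MP) -> (forall i, (p i)^`M(l) = (b i)%:MP) ->
  ((\sum_i p i ^+ m.+2)^`M(k)^`M(l)).@[v]
    = m.+2%:R * m.+1%:R * \sum_i a i * ((p i).@[v] ^+ m * b i).
Proof.
move=> dk dl.
rewrite (raddf_sum (mderiv k)) (raddf_sum (mderiv l)) (raddf_sum (meval v)).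
rewrite mulr_sumr; apply: eq_bigr => i _.
rewrite [LHS]/= mderiv_exp dk [_ * (a i)%:MP]mulrC 2!(mderiv_mulC l).
by rewrite mderiv_exp dl !mevalM !mevalC rmorphXn /=; ring.
Qed.

(* Differentiating twice compares Hessians: [A^T diag(z_i^m) A = c diag(y_j^m)];
   then evaluate at the [j]th basis vector. *)
Lemma fermat_hessian (F : fieldType) (n m : nat) (c : F) (A : 'M[F]_n) :
  m.+2%:R != 0 :> F -> m.+1%:R != 0 :> F -> (0 < m)%N ->
  c%:MP * (\sum_(j < n) 'X_j ^+ m.+2) =
    \sum_(i < n) (\sum_(j < n) A i j *: 'X_j : {mpoly F[n]}) ^+ m.+2 ->
  forall j k l, \sum_(i < n) A i k * (A i j ^+ m * A i l)
    = if (k == l) && (k == j) then c else 0.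
Proof.
move=> nz2 nz1 m_gt0 eqA j k l.
pose v (h : 'I_n) : F := (h == j)%:R.
have hessX := meval_hessian_sum_exp _ _ _ m _ _ _ k l v
  (mderivXU n F k) (mderivXU n F l).
have hessA := meval_hessian_sum_exp _ _ _ m _ _ _ k l v
  (fun i => mderiv_linear_form n F (A i) k)
  (fun i => mderiv_linear_form n F (A i) l).
move: hessA; rewrite -eqA (mderiv_mulC k) (mderiv_mulC l) mevalM mevalC.
rewrite hessX mulrCA => /(mulfI (mulf_neq0 nz2 nz1)) eq_kl.
have evA i : (\sum_(h < n) A i h *: 'X_h : {mpoly F[n]}).@[v] = A i j.
  rewrite (raddf_sum (meval v)) (bigD1 j) //= big1 => [|h ne_hj].
    by rewrite mevalZ mevalXU /v eqxx mulr1 addr0.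
  by rewrite mevalZ mevalXU /v (negbTE ne_hj) mulr0.
under eq_bigr do rewrite -evA.
rewrite -eq_kl (bigD1 k) //= big1 => [|h ne_hk]; last first.
  by rewrite (negbTE ne_hk) mul0r.
rewrite eqxx mevalXU /v addr0 mul1r.
case: (k == l); case: (k == j); rewrite ?mulr0 //= ?expr1n ?mulr1 //.
(* Here [k = l] but [k != j], and [0 ^+ m] vanishes because [m > 0]. *)
by rewrite expr0n gtn_eqF // mulr0.
Qed.

(* [A^T diag(A i j ^+ m) A = c E_jj] for all [j]. Summing over [j] shows that [A]
   is invertible, so [diag(A i j ^+ m)] has rank one and column [j] of [A] has a
   single nonzero entry, an [m.+2]th root of [c]. *)
Lemma fermat_similarity_ratio (F : fieldType) (n m : nat) (c : F)
    (A : 'M[F]_n) (j : 'I_n) :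
  (0 < m)%N -> c != 0 ->
  (forall j k l, \sum_(i < n) A i k * (A i j ^+ m * A i l)
    = if (k == l) && (k == j) then c else 0) ->
  exists a, a ^+ m.+2 = c.
Proof.
move=> m_gt0 nz_c eqA.
pose D h : 'M[F]_n := diag_mx (\row_i A i h ^+ m).
have DE h : A^T *m (D h *m A) = c *: delta_mx h h.
  apply/matrixP=> k l; rewrite !mxE.
  under eq_bigr do rewrite mul_diag_mx !mxE.
  rewrite eqA; case: (eqVneq k l) => [<-|ne_kl] /=.
    by rewrite andbb; case: eqP; rewrite ?mulr1 ?mulr0.
  case: (eqVneq k h) => [<-|_] /=; last by rewrite mulr0.
  by rewrite eq_sym (negbTE ne_kl) mulr0.
have uA : A \in unitmx.
  have: c^-1 *: (A^T *m (\sum_h D h)) *m A = 1%:M.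
    rewrite -scalemxAl -mulmxA mulmx_suml mulmx_sumr.
    rewrite (eq_bigr _ (fun h _ => DE h)) -scaler_sumr scalerA mulVf // scale1r.
    by rewrite -mx1_sum_delta.
  by case/mulmx1_unit.
pose B := invmx A.
have DjE : D j = c *: (B^T *m delta_mx j j *m B).
  rewrite scalemxAl scalemxAr -DE (mulmxA B^T) -trmx_mul mulmxV // trmx1.
  by rewrite mul1mx -mulmxA mulmxV // mulmx1.
have DjE' i i' : D j i i' = c * (B j i * B j i').
  rewrite DjE mxE; congr (_ * _).
  (* [delta_mx j j] is a column times a row, so [B^T *m delta_mx j j *m B] is the outer product of
     row [j] of [B] with itself. *)
  rewrite -(mul_delta_mx (0 : 'I_1)) mulmxA -mulmxA -colE -rowE.
  by rewrite mxE big_ord1 !mxE.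
have := eqA j j j; rewrite !eqxx /= => sum_c.
have [i nz_i] : exists i, A i j != 0.
  apply/existsP; apply: contraT; rewrite negb_exists => /forallP A0.
  move: nz_c; rewrite -sum_c big1 ?eqxx // => i _.
  by have /negPn/eqP-> := A0 i; rewrite mul0r.
have nzB h : A h j != 0 -> B j h != 0.
  move=> nz_h; have := DjE' h h; rewrite !mxE eqxx mulr1n => eqh.
  by apply: contraNneq (expf_neq0 m nz_h) => B0; rewrite eqh B0 mul0r mulr0.
exists (A i j); rewrite -sum_c (bigD1 i) //= big1 => [|h ne_hi].
  by rewrite -exprSr -exprS addr0.
(* [D j] is diagonal, so its entry at [(h, i)] is zero; a second nonzero [A h j] would make that
   entry, [c * (B j h * B j i)], nonzero. *)
have [->|nz_h] := eqVneq (A h j) 0; first by rewrite mul0r.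
have := DjE' h i; rewrite !mxE (negbTE ne_hi) mulr0n => /esym/eqP.
by rewrite !mulf_eq0 !(negbTE (nzB _ _)) // (negbTE nz_c).
Qed.

(* In lowest terms [q] is constant; then [p] divides ['X^d + s] and, through the
   derivative, ['X^(d.-1)], hence [s]. *)
Lemma Xn_addC_neq_expf (F : fieldType) (d : nat) (s : F) (p q : {poly F}) :
  (1 < d)%N -> d%:R != 0 :> F -> s != 0 -> q != 0 ->
  ('X^d + s%:P) * q ^+ d != p ^+ d.
Proof.
move=> d_gt1 nz_d nz_s nz_q; apply/eqP=> eq_pq.
have d_gt0 : (0 < d)%N by apply: ltnW.
pose g := gcdp p q; pose p' := p %/ g; pose q' := q %/ g.
have nz_g : g != 0 by rewrite gcdp_eq0 negb_and nz_q orbT.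
have eq' : ('X^d + s%:P) * q' ^+ d = p' ^+ d.
  apply: (mulIf (expf_neq0 d nz_g)).
  by rewrite -mulrA -!exprMn !divpK ?dvdp_gcdl ?dvdp_gcdr.
have cop : coprimep p' q' by rewrite coprimep_div_gcd // nz_q orbT.
(* By [eq'], [q'] divides [p' ^+ d], to which it is coprime; so it is coprime to itself. *)
have /size_poly1P[u nz_u q'E] : size q' == 1%N.
  rewrite -(coprimepp q'); apply: coprimep_dvdr (coprimep_expl d cop).
  rewrite -eq'; apply: dvdp_mull; exact: dvdp_exp.
rewrite q'E -rmorphXn /= in eq'; set w := u ^+ d in eq'.
have nz_w : w != 0 by apply: expf_neq0.
have dvd_Xd : p' %| 'X^d.
  have /(congr1 deriv) := eq'.
  rewrite deriv_exp derivM derivD derivXn !derivC addr0 mulr0 addr0 => eq_der.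
  have : p' %| 'X^(d.-1) *+ d * w%:P.
    rewrite eq_der -scaler_nat dvdpZr // dvdp_mull // dvdp_exp //.
    by rewrite -ltnS prednK.
  rewrite mulrC mul_polyC -scaler_nat !dvdpZr // => /dvdp_trans; apply.
  by rewrite dvdp_exp2l // leq_pred.
have dvd_s : p' %| s%:P.
  rewrite -(dvdp_addr _ dvd_Xd) -(dvdpZr _ _ nz_w) -mul_polyC mulrC eq'.
  exact: dvdp_exp.
(* Degrees clash: [p'] divides a nonzero constant, yet [p' ^+ d] has degree [d]. *)
have : size (p' ^+ d) = d.+1.
  by rewrite -eq' mulrC mul_polyC size_scale // size_XnaddC.
have: (size p' <= 1)%N.
  by rewrite (leq_trans (dvdp_leq _ dvd_s)) ?polyC_eq0 ?size_polyC_leq1.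
move/size1_polyC->; rewrite -rmorphXn /= => size_c.
by have := size_polyC_leq1 (p'`_0 ^+ d); rewrite size_c ltnS leqNgt d_gt0.
Qed.

Lemma fraction_surj (R : idomainType) (x : {fraction R}) :
  exists2 y : R * R, y.2 != 0 & x * FracField.tofrac y.2 = FracField.tofrac y.1.
Proof.
elim/quotW: x => y; exists (val y); first exact: denom_ratioP.
rewrite -[LHS]/(FracField.mul _ _) !piE; apply/eqmodP; rewrite /=.
rewrite FracField.equivfE /FracField.mulf !numden_Ratio ?mulf_neq0 ?oner_eq0
  ?denom_ratioP //.
by rewrite !mulr1 mulrC.
Qed.

Lemma natr_neq0_pchar_gt (k : fieldType) (d m : nat) :
  [pchar k] =i pred0 \/ (exists2 p : nat, p \in [pchar k] & (d < p)%N) ->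
  (0 < m <= d)%N -> m%:R != 0 :> k.
Proof.
move=> hchar /andP[m_gt0 le_md]; case: hchar => [/pcharf0P-> | [p char_p lt_dp]].
  by rewrite -lt0n.
rewrite -(dvdn_pcharf char_p); apply/negP=> /(dvdn_leq m_gt0).
by rewrite leqNgt (leq_ltn_trans le_md lt_dp).
Qed.

(** The underlying polynomial takes the value 1 at the [i]th basis vector. The predicate [P] covers
    both the full sum and the sum with one variable left out. *)
Lemma sum_ratvar_exp_neq0 (k : fieldType) (r d : nat) (P : pred 'I_r)
  (i : 'I_r) : (0 < d)%N -> P i -> \sum_(j < r | P j) ratvar k j ^+ d != 0.
Proof.
move=> d_gt0 Pi.
have -> : \sum_(j < r | P j) ratvar k j ^+ d
    = FracField.tofrac (\sum_(j < r | P j) ('X_j : {mpoly k[r]}) ^+ d).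
  by rewrite rmorph_sum; apply: eq_bigr => j _; rewrite rmorphXn.
rewrite tofrac_eq0.
apply: contra_neq (oner_neq0 k) => /(congr1 (meval (fun j => (j == i)%:R))).
rewrite raddf_sum meval0 (bigD1 i) //= big1 => [|j /andP[_ ne_ji]].
  by rewrite addr0 rmorphXn /= mevalXU eqxx expr1n.
by rewrite rmorphXn /= mevalXU (negbTE ne_ji) expr0n gtn_eqF.
Qed.

(** Injectivity holds because evaluating the new variable at [ratvar k i0] turns [phi] back into the
    inclusion of [k[x]] in [k(x)]. *)
Lemma mpoly_embed_poly (k : fieldType) (r : nat) (i0 : 'I_r) :
  exists2 phi : {rmorphism {mpoly k[r]} -> {poly {fraction {mpoly k[r]}}}},
    injective phi &
    forall i, phi 'X_i = if i == i0 then 'X else (ratvar k i)%:P.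
Proof.
pose emb : {rmorphism k -> {fraction {mpoly k[r]}}} :=
  @FracField.tofrac _ \o @mpolyC r k.
pose h i : {poly {fraction {mpoly k[r]}}} :=
  if i == i0 then 'X else (ratvar k i)%:P.
pose phi : {rmorphism {mpoly k[r]} -> {poly {fraction {mpoly k[r]}}}} :=
  mmap (polyC \o emb) h.
exists phi => [|i]; last by rewrite /phi /= mmapX mmap1U.
have phiK p : (phi p).[ratvar k i0] = FracField.tofrac p.
  rewrite /phi; elim/mpolyind: p => [|c m p _ _ IHp].
    by rewrite rmorph0 horner0 tofrac0.
  rewrite rmorphD hornerD tofracD; congr (_ + _); last exact: IHp.
  rewrite /= mmapZ mmapX hornerM /= hornerC -mul_mpolyC tofracM.
  congr (_ * _); rewrite /mmap1 horner_prod mpolyXE_id.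
  rewrite (rmorph_prod (@FracField.tofrac _)); apply: eq_bigr => i _.
  rewrite horner_exp rmorphXn /h /=; congr (_ ^+ _).
  by case: eqP => [->|_]; rewrite ?hornerX ?hornerC.
by move=> p q eq_phi; apply/eqP; rewrite -tofrac_eq -!phiK eq_phi.
Qed.

(* [k[x]] embeds in [K[t]], for [K = k(x)], by sending one variable to [t]
   and the others to constants; there the sum becomes [t^d + s] with [s] a
   nonzero constant. *)
Lemma sum_ratvar_exp_not_exp (k : fieldType) (r d : nat)
  (a : {fraction {mpoly k[r]}}) :
  (1 < r)%N -> (1 < d)%N -> d%:R != 0 :> k ->
  a ^+ d != \sum_(i < r) ratvar k i ^+ d.
Proof.
move=> r_gt1 d_gt1 nz_d; apply/eqP=> eq_a.
pose i0 : 'I_r := Ordinal (ltnW r_gt1).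
have [phi phi_inj phiX] := mpoly_embed_poly k r i0.
have [[p q] /= nz_q eq_pq] := fraction_surj _ a.
have nz_phi : phi q != 0 by rewrite -(rmorph0 phi) (inj_eq phi_inj).
pose s := \sum_(i < r | i != i0) ratvar k i ^+ d.
have nz_s : s != 0.
  (* Since [r > 1], there is an index other than [i0]. *)
  by apply: (@sum_ratvar_exp_neq0 _ _ _ _ (Ordinal r_gt1)); first exact: ltnW.
have nz_dK : d%:R != 0 :> {fraction {mpoly k[r]}}.
  by rewrite -(rmorph_nat (@FracField.tofrac _ \o @mpolyC r k)) fmorph_eq0.
have /eqP[] := Xn_addC_neq_expf _ _ _ (phi p) _ d_gt1 nz_dK nz_s nz_phi.
(* Clearing denominators in [eq_a] gives an identity in [k[x]], which [phi] can transport. *)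
have : (\sum_(i < r) 'X_i ^+ d) * q ^+ d = p ^+ d.
  apply/eqP; rewrite -tofrac_eq; apply/eqP.
  rewrite rmorphM !rmorphXn /= -eq_pq exprMn eq_a rmorph_sum /=; congr (_ * _).
  by apply: eq_bigr => i _; rewrite rmorphXn.
move/(congr1 phi); rewrite rmorphM (rmorphXn phi _ p) => <-.
rewrite (rmorphXn phi _ q) (rmorph_sum phi) (bigD1 i0) //=; congr ((_ + _) * _).
  by rewrite rmorphXn phiX eqxx.
rewrite (rmorph_sum polyC); apply: eq_bigr => i ne_i.
by rewrite (rmorphXn phi) (rmorphXn polyC) phiX (negbTE ne_i).
Qed.

Theorem theorem3p1 (d : nat) (k : fieldType) (r n : nat) (hd : (2 < d)%N)
  (hchar : [pchar k] =i pred0 \/ exists2 p : nat, p \in [pchar k] & (d < p)%N)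
  (hr : (1 <= r)%N) (hn : (1 <= n)%N) :
  (exists z : 'I_n -> {mpoly {fraction {mpoly k[r]}}[n]},
     (forall i : 'I_n, linear_form (z i)) /\
     (\sum_(i < r) ratvar k i ^+ d)%:MP * (\sum_(j < n) 'X_j ^+ d)
       = \sum_(i < n) z i ^+ d)
  <-> r = 1%N.
Proof.
split=> [[z [lin_z eq_z]] | r1]; last first.
  (* For [r = 1] the factor is the [d]th power of [x_1], so [z_i = x_1 y_i] works. *)
  subst r; exists (fun i => ratvar k ord0 *: 'X_i); split=> [i|].
    exists (fun j => if j == i then ratvar k ord0 else 0).
    rewrite (bigD1 i) //= eqxx big1 ?addr0 // => j /negbTE->.
    by rewrite scale0r.
  rewrite big_ord1 mulr_sumr; apply: eq_bigr => i _.
  by rewrite mul_mpolyC exprZn.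
(* With [d = m + 2], [hd] computes to [0 < m], and the Hessian constants [m + 2] and [m + 1] are
   nonzero by the assumption on the characteristic. *)
case: d hd hchar eq_z => [|[|m]] // hd hchar eq_z.
have nz_nat j : (0 < j <= m.+2)%N -> j%:R != 0 :> k.
  exact: natr_neq0_pchar_gt.
have nz_natK j : (0 < j <= m.+2)%N -> j%:R != 0 :> {fraction {mpoly k[r]}}.
  move/nz_nat => nz_j.
  by rewrite -(rmorph_nat (@FracField.tofrac _ \o @mpolyC r k)) fmorph_eq0.
have [A zE] : exists A : 'M[{fraction {mpoly k[r]}}]_n,
    forall i, z i = \sum_(j < n) A i j *: 'X_j.
  have [c cE] := fin_all_exists lin_z.
  exists (\matrix_(i, j) c i j) => i; rewrite cE.
  by apply: eq_bigr => j _; rewrite mxE.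
have eq_zA := etrans eq_z
  (eq_bigr _ (fun i _ => congr1 (fun p => p ^+ m.+2) (zE i))).
have eqA := fermat_hessian _ _ _ _ _
  (nz_natK m.+2 (leqnn _)) (nz_natK m.+1 (leqnSn _)) hd eq_zA.
have nz_c := sum_ratvar_exp_neq0 k r m.+2 predT (Ordinal hr) isT isT.
(* Any column of [A] would do; [n >= 1] provides the first. *)
have [a eq_a] := fermat_similarity_ratio _ _ _ _ _ (Ordinal hn) hd nz_c eqA.
apply/eqP; rewrite eqn_leq hr andbT leqNgt; apply/negP=> r_gt1.
have /eqP := sum_ratvar_exp_not_exp _ _ m.+2 a r_gt1 isT (nz_nat m.+2 (leqnn _)).
exact.
Qed.
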